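(* Let $p$ be a prime, $k\ge 1$, $R=\mathbb{Z}_{p^k}$ and $m\ge1$. Every subgroup $C\le R^m$ is of the form $C=\langle PQ\omega\rangle$ where: (a) $P\in R^{l,m}$ for some $l\le m$, with $P_{i,j}=\delta_{i,j}\,p^{r_i}$ and $0\le r_1\le\cdots\le r_l<k$; (b) $Q\in \mathrm{GL}(m,R)$ is upper triangular with all diagonal entries equal to $1$, and $0\le Q_{i,j}<p^{r_j-r_i}$ for all $j>i$ (with the convention $r_i=k$ for $i>l$); (c) $\omega\in\Sigma_m$ is a permutation matrix. Moreover $C\cong \mathbb{Z}_{p^{k-r_l}}\times\cdots\times\mathbb{Z}_{p^{k-r_1}}$; hence $P$ is uniquely determined by $C$.
   Context: For a matrix $U$ with entries in $R$, $\langle U\rangle$ denotes its row space, i.e. the subgroup of $R^m$ generated by the rows of $U$. Elements of $\mathbb{Z}_{p^k}$ are identified with their representatives in $\{0,1,\dots,p^k-1\}$, which gives meaning to inequalities such as $0\le Q_{i,j}<p^{r_j-r_i}$. A permutation $\tau\in\Sigma_m$ is identified with the permutation matrix given by $\tau_{i,j}=\delta_{i,\tau(j)}$. *)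

(* Defs.v *)
From HB Require Import structures.
From mathcomp Require Import all_boot all_order all_algebra all_fingroup all_solvable.

Set Implicit Arguments.
Unset Strict Implicit.
Unset Printing Implicit Defensive.

Import GRing.Theory.
Local Open Scope ring_scope.

(* The finite group structure on 'rV[R]_m is the additive one. *)
Definition row_space (R : finNzRingType) (l m : nat) (U : 'M[R]_(l, m)) :
    {set 'rV[R]_m} :=
  <<[set row i U | i : 'I_l]>>%g.

(* This is perm_mx w^-1 in the library's convention. *)
Definition perm_matrix (R : nzRingType) (m : nat) (w : 'S_m) : 'M[R]_m :=
  \matrix_(i, j) (i == w j)%:R.

Definition diag_factor (p k l m : nat) (r : l.-tuple nat)
    (P : 'M['Z_(p ^ k)]_(l, m)) : Prop :=
  [/\ (l <= m)%N,
      sorted leq r,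
      forall i : 'I_l, (tnth r i < k)%N
    & forall (i : 'I_l) (j : 'I_m),
        P i j = if i == j :> nat then (p ^ tnth r i)%:R else 0].

(* Indices start at 0, so nth k r i implements the convention that the exponent
   is k beyond the l-th one. The coercion of Q i j to nat is its representative
   in {0, ..., p ^ k - 1}. The truncated difference of exponents is exact when r
   is sorted and bounded by k. *)
Definition unitriangular_factor (p k l m : nat) (r : l.-tuple nat)
    (Q : 'M['Z_(p ^ k)]_m) : Prop :=
  [/\ Q \in unitmx,
      forall i j : 'I_m, (j < i)%N -> Q i j = 0,
      forall i : 'I_m, Q i i = 1
    & forall i j : 'I_m, (i < j)%N ->
        (Q i j < p ^ (nth k r j - nth k r i))%N].

Definition decomposition (p k m : nat) (C : {set 'rV['Z_(p ^ k)]_m})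
    (l : nat) (r : l.-tuple nat) (P : 'M['Z_(p ^ k)]_(l, m))
    (Q : 'M['Z_(p ^ k)]_m) (w : 'S_m) : Prop :=
  [/\ diag_factor r P,
      unitriangular_factor r Q
    & C = row_space (P *m Q *m perm_matrix _ w)].

(* Main.v *)
(** A smallest power [p ^ r] occurring among the entries of the elements of [C]
    divides every such entry. Moving it to the first coordinate and clearing that
    coordinate splits [C] into the multiples of one row and a submodule of
    [R^(m-1)], so induction yields [C = <D Q w>] with [D] diagonal with increasing
    exponents (bounded by [k], where [p ^ k = 0]) and [Q] unitriangular. Euclidean
    division, column by column, then reduces every row of [Q] modulo the rows
    below it. For any such [P] and invertible [U], two coefficient vectors [y] and
    [z] give the same element [y P U = z P U] exactly when [y_i = z_i] modulo
    [p ^ (k - r_i)]; this gives the isomorphism type, and the order of every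
    [p ^ s C], which is [p] to the sum of the truncated differences
    [k - s - r_i]. These sums, for all [s], determine the exponents. *)

Require Import Defs.
From HB Require Import structures.
From mathcomp Require Import all_boot all_order all_algebra all_fingroup all_solvable.

Set Implicit Arguments.
Unset Strict Implicit.
Unset Printing Implicit Defensive.

Import GRing.Theory.
Local Open Scope ring_scope.

(** * Powers of [p] modulo [p ^ k] *)

Lemma natr_Zp_eq0 (q a : nat) : (1 < q)%N -> ((a%:R : 'Z_q) == 0) = (q %| a)%N.
Proof. by move=> q_gt1; rewrite -val_eqE /= val_Zp_nat. Qed.

Lemma prime_power_gt1 (p k : nat) : prime p -> (0 < k)%N -> (1 < p ^ k)%N.
Proof. by move=> p_pr k_gt0; rewrite -(exp1n k) ltn_exp2r // prime_gt1. Qed.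

Lemma dvdn_exp_mul_subn (p k e a : nat) :
  prime p -> (p ^ k %| a * p ^ e)%N = (p ^ (k - e) %| a)%N.
Proof.
move=> p_pr; have p_gt0 := prime_gt0 p_pr.
case: (leqP k e) => [le_ke | /ltnW le_ek].
  by rewrite (eqP (_ : k - e == 0)%N) ?subn_eq0 // dvd1n dvdn_mull // dvdn_exp2l.
by rewrite -{1}(subnK le_ek) expnD dvdn_pmul2r // expn_gt0 p_gt0.
Qed.

Lemma natr_mul_exp_eq0 (p k e a : nat) : prime p -> (0 < k)%N ->
  ((a%:R * (p ^ e)%:R : 'Z_(p ^ k)) == 0) = (p ^ (k - e) %| a)%N.
Proof.
move=> p_pr k_gt0.
by rewrite -natrM natr_Zp_eq0 ?prime_power_gt1 // dvdn_exp_mul_subn.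
Qed.

Lemma eq_natr_mul_exp (p k e a b : nat) : prime p -> (0 < k)%N ->
  ((a%:R * (p ^ e)%:R : 'Z_(p ^ k)) == b%:R * (p ^ e)%:R)
    = (a == b %[mod p ^ (k - e)])%N.
Proof.
move=> p_pr k_gt0; wlog le_ba : a b / (b <= a)%N => [IH | ].
  by case: (leqP b a) => [/IH // | /ltnW/IH]; rewrite eq_sym => ->; rewrite eq_sym.
by rewrite -subr_eq0 -mulrBl -natrB // natr_mul_exp_eq0 // eqn_mod_dvd.
Qed.

Lemma natr_exp_ge (p k : nat) (e : nat) : prime p -> (0 < k)%N ->
  (k <= e)%N -> (p ^ e)%:R = 0 :> 'Z_(p ^ k).
Proof.
move=> p_pr k_gt0 le_ke; apply/eqP.
by rewrite natr_Zp_eq0 ?prime_power_gt1 // dvdn_exp2l.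
Qed.

(** The unit is the part of the representative coprime to [p]. Zero takes exponent [k], as [p ^ k]
    vanishes. *)
Lemma Zp_unit_mul_exp (p k : nat) (a : 'Z_(p ^ k)) : prime p -> (0 < k)%N ->
  exists2 s, (s <= k)%N &
  exists2 u : 'Z_(p ^ k), u \is a GRing.unit & a = u * (p ^ s)%:R.
Proof.
move=> p_pr k_gt0; have q_gt1 := prime_power_gt1 p_pr k_gt0.
have [->|a_neq0] := eqVneq a 0.
  by exists k => //; exists 1; rewrite ?unitr1 // natr_exp_ge ?mulr0.
have a_gt0 : (0 < a)%N by rewrite lt0n.
have [s cps Da] := pfactor_coprime p_pr a_gt0.
set t := logn p a in Da.
exists t; last first.
  exists s%:R; first by rewrite unitZpE // coprimeXl.
  by rewrite -natrM -Da natr_Zp.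
have lt_aq : (a < p ^ k)%N by rewrite -[X in (_ < X)%N]Zp_cast.
have : (p ^ t <= a)%N by apply: dvdn_leq; rewrite // Da dvdn_mull.
by move/leq_ltn_trans/(_ lt_aq); rewrite ltn_exp2l ?prime_gt1 // => /ltnW.
Qed.

(** * Submodules and row spaces *)

(** Stated for bare sets, so that the induction below applies to a set given by comprehension
    without building a group on it. *)
Definition submodule (R : finNzRingType) (m : nat) (C : {set 'rV[R]_m}) :=
  0 \in C /\ forall a x y, x \in C -> y \in C -> a *: x + y \in C.

(** Every scalar of ['Z_q] is the image of a natural number, so scaling by it is a group power. *)
Lemma group_submodule (q m : nat) (C : {group 'rV['Z_q]_m}) : submodule C.
Proof.
split=> [|a x y Cx Cy]; first exact: group1.
have -> : a *: x + y = ((x ^+ a) * y)%g.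
  by rewrite FinRing.zmodXgE FinRing.zmodMgE -scaler_nat natr_Zp.
by rewrite groupM ?groupX.
Qed.

Section Submodule.
Variables (R : finNzRingType) (m : nat) (C : {set 'rV[R]_m}).
Hypothesis subC : submodule C.

Lemma submodule0 : 0 \in C. Proof. by case: subC. Qed.

Lemma submoduleZ a x : x \in C -> a *: x \in C.
Proof. by case: subC => C0 CZD Cx; rewrite -[_ *: _]addr0 CZD. Qed.

Lemma submoduleD x y : x \in C -> y \in C -> x + y \in C.
Proof. by case: subC => _ CZD Cx Cy; rewrite -[x]scale1r CZD. Qed.

Lemma submoduleB x y : x \in C -> y \in C -> x - y \in C.
Proof. by move=> Cx Cy; rewrite submoduleD // -scaleN1r submoduleZ. Qed.

Lemma submodule_mulmx (l : nat) (U : 'M[R]_(l, m)) (y : 'rV_l) :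
  (forall i, row i U \in C) -> y *m U \in C.
Proof.
move=> CU; rewrite mulmx_sum_row.
by elim/big_ind: _ => [|? ? ? ?|i _];
   [exact: submodule0 | exact: submoduleD | exact: submoduleZ].
Qed.
End Submodule.

Lemma row_spaceE (q l m : nat) (U : 'M['Z_q]_(l, m)) :
  row_space U = [set y *m U | y : 'rV_l].
Proof.
apply/eqP; rewrite eqEsubset; apply/andP; split.
  have gU : group_set [set y *m U | y : 'rV_l].
    apply/group_setP; split; first by apply/imsetP; exists 0; rewrite // mul0mx.
    move=> _ _ /imsetP[y _ ->] /imsetP[z _ ->]; apply/imsetP.
    by exists (y + z); rewrite // mulmxDl.
  rewrite /row_space (gen_subG _ (Group gU)) /=.
  apply/subsetP=> _ /imsetP[i _ ->]; rewrite rowE; apply/imsetP.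
  by exists (delta_mx 0 i).
apply/subsetP=> _ /imsetP[y _ ->].
apply: (submodule_mulmx (group_submodule [group of row_space U])) => i.
by rewrite mem_gen //; apply/imsetP; exists i.
Qed.

(** [A] may be rectangular: this covers both invertible row operations and the removal of zero
    rows. *)
Lemma row_space_mull (q l l' m : nat) (A : 'M['Z_q]_(l, l'))
    (B : 'M['Z_q]_(l', l)) (U : 'M['Z_q]_(l', m)) :
  B *m (A *m U) = U -> row_space (A *m U) = row_space U.
Proof.
move=> BAU; rewrite !row_spaceE; apply/setP=> x; apply/imsetP/imsetP=> -[y _ ->].
  by exists (y *m A); rewrite ?mulmxA.
by exists (y *m B); rewrite // -mulmxA BAU.
Qed.

(** * Unitriangular matrices and diagonal matrices of powers of [p] *)

Definition unitriangular (R : nzRingType) (m : nat) (Q : 'M[R]_m) :=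
  (forall i j : 'I_m, (j < i)%N -> Q i j = 0) /\ (forall i, Q i i = 1).

Lemma unitriangular_unitmx (R : comUnitRingType) (m : nat) (Q : 'M[R]_m) :
  unitriangular Q -> Q \in unitmx.
Proof.
case=> Q0 Q1; rewrite unitmxE -det_tr det_trig; last first.
  by apply/is_trig_mxP=> i j lt_ij; rewrite mxE Q0.
by rewrite big1 ?unitr1 // => i _; rewrite mxE Q1.
Qed.

(** The default [k] of [nth] makes the diagonal entries beyond the end of [rs] equal to [p ^ k],
    which is zero for [p] prime and [k] positive. *)
Definition exponent_mx (p k m : nat) (rs : seq nat) : 'M['Z_(p ^ k)]_m :=
  diag_mx (\row_i (p ^ nth k rs i)%:R).

Lemma exponent_mx_cons (p k m r : nat) (rs : seq nat) :
  exponent_mx p k m.+1 (r :: rs) =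
    block_mx (p ^ r)%:R%:M 0 0 (exponent_mx p k m rs) :> 'M_(1 + m).
Proof.
rewrite /exponent_mx -[LHS]/(diag_mx (_ : 'rV_(1 + m))).
have -> : \row_(i < 1 + m) (p ^ nth k (r :: rs) i)%:R =
    row_mx (p ^ r)%:R%:M (\row_i (p ^ nth k rs i)%:R) :> 'rV['Z_(p ^ k)]_(1 + m).
  apply/rowP=> i; rewrite !mxE; case: splitP => j -> /=; rewrite !mxE.
    by rewrite !ord1.
  by [].
rewrite diag_mx_row; congr block_mx.
by apply/matrixP=> i j; rewrite !mxE !ord1.
Qed.

Lemma row_exponent_mx (p k m n : nat) (rs : seq nat) (A : 'M['Z_(p ^ k)]_(m, n))
    (i : 'I_m) :
  row i (exponent_mx p k m rs *m A) = (p ^ nth k rs i)%:R *: row i A.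
Proof. by apply/rowP=> j; rewrite mul_diag_mx !mxE. Qed.

(** Multiplying by [p ^ (k - r)] kills the right-hand side, so [p ^ k] divides [p ^ (k - r + s)]. *)
Lemma exp_dvd_Zp (p k r s : nat) (a : 'Z_(p ^ k)) : prime p -> (0 < k)%N ->
  (r <= k)%N -> (p ^ s)%:R = (p ^ r)%:R * a -> (r <= s)%N.
Proof.
move=> p_pr k_gt0 le_rk /(congr1 (fun x => (p ^ (k - r))%:R * x)) /eqP.
rewrite mulrA -!natrM -!expnD subnK // (@natr_exp_ge p k k) // mul0r.
rewrite natr_Zp_eq0 ?prime_power_gt1 // dvdn_Pexp2l ?prime_gt1 //.
by rewrite -{1}(subnK le_rk) leq_add2l.
Qed.

(** * Existence of a decomposition with unreduced [Q] *)

(** The zero vector shows that exponent [k] occurs, so a least one exists. An entry of [z] is a unit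
    times some [p ^ s]; rescaling [z] by the inverse unit makes [p ^ s] itself an entry, whence
    [r <= s]. *)
Lemma minimal_exponent (p k m : nat) (C : {set 'rV['Z_(p ^ k)]_m.+1}) :
  prime p -> (0 < k)%N -> submodule C ->
  exists r (x : 'rV_m.+1) j, [/\ (r <= k)%N, x \in C, x 0 j = (p ^ r)%:R &
    forall z, z \in C -> exists z', z = (p ^ r)%:R *: z'].
Proof.
move=> p_pr k_gt0 subC.
pose has_entry r := [exists x in C, exists j, x 0 j == (p ^ r)%:R].
have entry_k : has_entry k.
  apply/exists_inP; exists 0; first exact: submodule0.
  by apply/existsP; exists 0; rewrite mxE natr_exp_ge.
case: (ex_minnP (ex_intro _ k entry_k)) => r.
case/exists_inP=> x Cx /existsP[j /eqP xj] r_min.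
exists r, x, j; split=> // [|z Cz]; first exact: r_min.
have /fin_all_exists[z' Dz'] i : exists a, z 0 i = (p ^ r)%:R * a.
  have [s _ [u Uu Dz]] := Zp_unit_mul_exp (z 0 i) p_pr k_gt0.
  have le_rs : (r <= s)%N.
    apply/r_min/exists_inP; exists (u^-1 *: z); first exact: submoduleZ.
    by apply/existsP; exists i; rewrite mxE Dz mulKr.
  exists (u * (p ^ (s - r))%:R).
  by rewrite Dz mulrCA -natrM -expnD subnKC.
by exists (\row_i z' i); apply/rowP=> i; rewrite !mxE.
Qed.

(** Exponents equal to [k] are kept here, so that all matrices stay square; their zero rows are
    dropped later. *)
Lemma exists_unreduced_decomposition (p k m : nat) (C : {set 'rV['Z_(p ^ k)]_m}) :
  prime p -> (0 < k)%N -> submodule C ->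
  exists (rs : seq nat) (Q : 'M['Z_(p ^ k)]_m) (w : 'S_m),
    [/\ size rs = m, sorted leq rs, all (fun r => r <= k)%N rs, unitriangular Q
      & C = [set y *m (exponent_mx p k m rs *m Q *m perm_mx w) | y : 'rV_m]].
Proof.
move=> p_pr k_gt0; elim: m C => [|n IHn] C subC.
  exists [::], 1%:M, 1%g; split=> //; first by split=> [[]|[]].
  apply/setP=> x; rewrite [x]thinmx0 submodule0 //; apply/esym/imsetP.
  by exists 0 => //; rewrite thinmx0.
have [r [x [j [le_rk Cx xj dvdC]]]] := minimal_exponent p_pr k_gt0 subC.
(* The involution [T] swaps coordinates [0] and [j], bringing the minimal entry of [x] to the
   front. *)
pose T : 'M['Z_(p ^ k)]_(1 + n) := perm_mx (tperm 0 j).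
have TT : T *m T = 1%:M by rewrite -perm_mxM tperm2 perm_mx1.
have mulTE (A : 'rV_(1 + n)) i : (A *m T) 0 i = A 0 (tperm 0 j i).
  by rewrite /T -[X in perm_mx X]tpermV -col_permE mxE.
(* [C1] consists of the elements of [C] that vanish at [j], swapped by [T] and stripped of their
   leading zero. *)
pose C1 := [set v : 'rV['Z_(p ^ k)]_n | (row_mx 0 v : 'rV_(1 + n)) *m T \in C].
have subC1 : submodule C1.
  split=> [|a u v]; rewrite !inE; first by rewrite row_mx0 mul0mx submodule0.
  move=> Cu Cv; have -> : row_mx 0 (a *: u + v) =
      a *: row_mx 0 u + row_mx 0 v :> 'rV['Z_(p ^ k)]_(1 + n).
    by rewrite scale_row_mx add_row_mx scaler0 addr0.
  by rewrite mulmxDl -scalemxAl submoduleD // submoduleZ.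
have [rs1 [Q1 [w1 [size_rs1 sort_rs1 le_rs1 [Q10 Q11] DC1]]]] := IHn C1 subC1.
have [x' Dx] := dvdC x Cx.
pose G1 := exponent_mx p k n rs1 *m Q1 *m perm_mx w1.
pose v := rsubmx (x' *m T : 'rV_(1 + n)).
have DxT : x *m T = row_mx (p ^ r)%:R%:M ((p ^ r)%:R *: v) :> 'rV_(1 + n).
  rewrite -[LHS]hsubmxK; congr row_mx.
    apply/rowP=> i; rewrite !ord1 mxE mulTE mxE mulr1n.
    by rewrite (_ : lshift n 0 = 0) ?tpermL ?xj //; apply/val_inj.
  by rewrite {1}Dx -scalemxAl linearZ.
(* The factor [w1^-1] cancels the permutation [w1] that is later applied on the right to the last
   [n] columns. *)
pose Q : 'M['Z_(p ^ k)]_(1 + n) := block_mx 1%:M (v *m perm_mx w1^-1) 0 Q1.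
(* The rows of the product are [x] and the generators of [C1] put back into [C]. *)
have DG : (exponent_mx p k n.+1 (r :: rs1) : 'M_(1 + n)) *m Q
      *m perm_mx (lift0_perm w1 * tperm 0 j)
    = col_mx x (row_mx 0 G1 *m T) :> 'M_(1 + n).
  rewrite perm_mxM -lift0_mx_perm -[lift0_mx _]/(block_mx 1%:M 0 0 (perm_mx w1)).
  rewrite exponent_mx_cons /Q mulmxA !(@mulmx_block _ 1 n 1 n 1 n).
  rewrite !(mul0mx, mulmx0, addr0, add0r, mulmx1) mul_scalar_mx -scalemxAl.
  rewrite -(mulmxA v) -perm_mxM mulVg perm_mx1 mulmx1 -/T -/G1 -[x in RHS]mulmx1 -TT.
  by rewrite mulmxA DxT -mul_col_mx.
have C1G1 i : row i G1 \in C1.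
  by rewrite DC1; apply/imsetP; exists (delta_mx 0 i); rewrite // -rowE.
(* Row [i] of [G1] comes from an element of [C], hence is divisible by [p ^ r]; undoing [w1] exposes
   its diagonal entry, the power of [p] with the [i]-th exponent. *)
have le_r_rs1 : all (leq r) rs1.
  apply/(all_nthP k) => i; rewrite size_rs1 => lt_in; pose i0 := Ordinal lt_in.
  have := C1G1 i0; rewrite inE => /dvdC[z' /(congr1 (mulmxr T))] /=.
  rewrite -mulmxA TT mulmx1 -scalemxAl => /(congr1 rsubmx).
  rewrite row_mxKr linearZ /= => /(congr1 (mulmxr (perm_mx w1^-1))) /=.
  rewrite /G1 -row_mul -mulmxA -perm_mxM mulgV perm_mx1 mulmx1 row_exponent_mx.
  move=> /rowP/(_ i0); rewrite -scalemxAl !mxE Q11 mulr1.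
  exact: exp_dvd_Zp.
exists (r :: rs1), Q, (lift0_perm w1 * tperm 0 j)%g; split.
- by rewrite /= size_rs1.
- by rewrite /= path_sortedE ?le_r_rs1 //; apply: leq_trans.
- by rewrite /= le_rk.
- split=> [i i' lt_i'i | i]; rewrite !mxE.
    case: splitP => a Da; rewrite !mxE; case: splitP => b Db; rewrite ?mxE //.
    + by rewrite Da ord1 in lt_i'i.
    + by rewrite Da ord1 in lt_i'i.
    by apply: Q10; rewrite Da Db in lt_i'i.
  case: splitP => a Da; rewrite !mxE; case: splitP => b Db; rewrite ?mxE.
  + by rewrite !ord1.
  + by move: Db; rewrite Da ord1.
  + by move: Da; rewrite Db ord1.
  by have /val_inj -> : val a = val b; [apply: (@addnI 1); rewrite -Da | exact: Q11].
rewrite DG; apply/setP=> z; apply/idP/imsetP=> [Cz | [y _ ->]]; last first.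
  rewrite -[y](@hsubmxK _ 1 1 n) (@mul_row_col _ 1 1 n (1 + n)) submoduleD //.
    by rewrite [lsubmx _]mx11_scalar mul_scalar_mx submoduleZ.
  rewrite mulmxA mul_mx_row mulmx0.
  have : rsubmx (y : 'rV_(1 + n)) *m G1 \in C1 by apply: submodule_mulmx.
  by rewrite inE.
have [z' Dz] := dvdC z Cz.
(* [y0] is coordinate [j] of [z'], so [z] and [y0 *: x] agree at [j] and their difference comes from
   [C1]. *)
pose y0 := (z' *m T : 'rV_(1 + n)) 0 0.
pose u := rsubmx ((z - y0 *: x) *m T : 'rV_(1 + n)).
have Du : (z - y0 *: x) *m T = row_mx 0 u.
  rewrite -[LHS](@hsubmxK _ 1 1 n); congr row_mx; apply/rowP=> i.
  rewrite ord1 mxE mulTE (_ : lshift n 0 = 0) ?tpermL; last exact/val_inj.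
  by rewrite !mxE xj {1}Dz /y0 mulTE tpermL mxE mulrC subrr.
have : u \in C1 by rewrite inE -Du -mulmxA TT mulmx1 submoduleB // submoduleZ.
rewrite DC1 => /imsetP[y1 _ Dy1].
exists (row_mx y0%:M y1 : 'rV_(1 + n)) => //.
rewrite (@mul_row_col _ 1 1 n (1 + n)) mul_scalar_mx mulmxA mul_mx_row mulmx0.
rewrite /G1 -Dy1 -Du.
by rewrite -mulmxA TT mulmx1 addrC subrK.
Qed.

(** * Euclidean reduction of the entries of [Q] *)

(** Columns are treated from left to right. Row [j] of [Q] is zero before column [j] and has 1
    there, so subtracting a multiple of it corrects column [j] without disturbing the earlier
    ones. *)
Lemma reduce_row (p k m : nat) (e : 'I_m -> nat) (Q : 'M['Z_(p ^ k)]_m)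
    (i : 'I_m) (v : 'rV['Z_(p ^ k)]_m) :
  prime p -> (0 < k)%N -> unitriangular Q ->
  exists y : 'rV['Z_(p ^ k)]_m, (forall j : 'I_m, (j <= i)%N -> y 0 j = 0) /\
    forall j : 'I_m, (i < j)%N ->
      ((v - \sum_l y 0 l *: ((p ^ e l)%:R *: row l Q))%R ord0 j < p ^ e j)%N.
Proof.
move=> p_pr k_gt0 [Q0 Q1]; have q_gt1 := prime_power_gt1 p_pr k_gt0.
pose red (y : 'rV_m) := v - \sum_l y 0 l *: ((p ^ e l)%:R *: row l Q) : 'rV_m.
suff /(_ m)[y [y0 yP]] n : exists y : 'rV['Z_(p ^ k)]_m,
    (forall j : 'I_m, (j <= i)%N -> y 0 j = 0) /\
    forall j : 'I_m, (i < j < n)%N -> (red y ord0 j < p ^ e j)%N.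
  by exists y; split=> // j lt_ij; apply: yP; rewrite lt_ij ltn_ord.
elim: n => [|n [y [y0 yP]]].
  by exists 0; split=> [j _|j]; rewrite ?mxE // ltn0 andbF.
case: (leqP n i) => [le_ni | lt_in].
  exists y; split=> // j /andP[lt_ij]; rewrite ltnS => le_jn.
  by have := leq_trans (leq_trans lt_ij le_jn) le_ni; rewrite ltnn.
case: (leqP m n) => [le_mn | lt_nm].
  exists y; split=> // j /andP[lt_ij _]; apply: yP.
  by rewrite lt_ij (leq_trans (ltn_ord j)).
pose j0 := Ordinal lt_nm; pose c := red y 0 j0.
(* With this quotient as coefficient, column [j0] is left with the remainder modulo [p ^ e j0]. *)
pose a : 'Z_(p ^ k) := (c %/ p ^ e j0)%:R.
have red_y' : red (y + a *: delta_mx 0 j0) =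
    red y - a *: ((p ^ e j0)%:R *: row j0 Q).
  rewrite /red -addrA -opprD; congr (_ - _).
  under eq_bigr do rewrite mxE scalerDl.
  rewrite big_split /=; congr (_ + _).
  rewrite (bigD1 j0) //= big1 ?addr0 => [|l neq_l]; first by rewrite !mxE !eqxx mulr1.
  by rewrite !mxE (negPf neq_l) mulr0 scale0r.
exists (y + a *: delta_mx 0 j0); split=> [j le_ji | j /andP[lt_ij]].
  rewrite !mxE y0 // add0r (_ : j == j0 = false) ?andbF ?mulr0 //.
  by apply/eqP=> Dj; rewrite Dj leqNgt lt_in in le_ji.
rewrite red_y' ltnS leq_eqVlt => /predU1P[Dj | lt_jn]; last first.
  rewrite mxE [X in _ + X]mxE [X in - X]mxE [X in _ * X]mxE [row _ _ _ _]mxE.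
  by rewrite (Q0 j0) // !mulr0 subr0 yP // lt_ij.
have -> : j = j0 by apply: val_inj.
rewrite mxE [X in _ + X]mxE [X in - X]mxE [X in _ * X]mxE [row _ _ _ _]mxE.
rewrite Q1 mulr1 -/c /a -natrM.
have -> : c - (c %/ p ^ e j0 * p ^ e j0)%:R = (c %% p ^ e j0)%:R.
  by apply/eqP; rewrite subr_eq -natrD addnC -divn_eq natr_Zp.
rewrite val_Zp_nat //; apply: leq_ltn_trans (leq_mod _ _) _.
by rewrite ltn_mod expn_gt0 prime_gt0.
Qed.

(** Since [p ^ r_i * p ^ (r_l - r_i) = p ^ r_l], subtracting [p ^ (r_l - r_i)] times row [l] from
    row [i] of [Q] amounts, after scaling by the diagonal, to subtracting row [l] from row [i] of
    the product. All these operations together form the unitriangular [A = 1 - Y]. *)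
Lemma reduce_unitriangular (p k m : nat) (rs : seq nat) (Q : 'M['Z_(p ^ k)]_m) :
  prime p -> (0 < k)%N -> sorted leq rs -> size rs = m -> unitriangular Q ->
  exists Q' A : 'M['Z_(p ^ k)]_m,
    [/\ unitriangular Q', A \in unitmx,
        exponent_mx p k m rs *m Q' = A *m (exponent_mx p k m rs *m Q)
      & forall i j : 'I_m, (i < j)%N ->
          (Q' i j < p ^ (nth k rs j - nth k rs i))%N].
Proof.
move=> p_pr k_gt0 sort_rs size_rs uniQ; have [Q0 Q1] := uniQ.
pose e (i l : 'I_m) := (nth k rs l - nth k rs i)%N.
have /fin_all_exists[y yP] i := reduce_row (e i) i (row i Q) p_pr k_gt0 uniQ.
pose Y := \matrix_(i, j) y i 0 j.
pose Q' := \matrix_i (row i Q - \sum_l y i 0 l *: ((p ^ e i l)%:R *: row l Q)).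
(* Only rows [l > i] are subtracted, and these vanish in the columns [j <= i]. *)
have Q'E (i j : 'I_m) : (j <= i)%N -> Q' i j = Q i j.
  move=> le_ji; rewrite mxE mxE [X in X + _]mxE [X in _ + X]mxE summxE.
  rewrite big1 ?subr0 // => l _; rewrite mxE.
  case: (leqP l i) => [le_li | lt_il]; first by rewrite (yP i).1 // mul0r.
  by rewrite mxE [X in _ * (_ * X)]mxE Q0 ?mulr0 // (leq_ltn_trans le_ji).
have uniA : unitriangular (1%:M - Y).
  split=> [i j lt_ji | i].
    rewrite !mxE (yP i).1 ?(ltnW lt_ji) // subr0.
    by rewrite (_ : i == j = false) //; apply/eqP=> Dij; rewrite Dij ltnn in lt_ji.
  by rewrite !mxE (yP i).1 // eqxx subr0.
exists Q', (1%:M - Y); split.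
- split=> [i j lt_ji | i]; first by rewrite Q'E ?Q0 // ltnW.
  by rewrite Q'E.
- exact: unitriangular_unitmx.
- apply/row_matrixP=> i; rewrite row_exponent_mx mulmxBl mul1mx.
  rewrite [in RHS]linearB /= row_exponent_mx rowK scalerBr; congr (_ - _).
  rewrite row_mul mulmx_sum_row scaler_sumr; apply: eq_bigr => l _.
  rewrite row_exponent_mx !mxE; case: (leqP l i) => [le_li | lt_il].
    by rewrite (yP i).1 // !scale0r scaler0.
  have le_r : (nth k rs i <= nth k rs l)%N.
    by apply: (sorted_leq_nth leq_trans leqnn); rewrite ?inE ?size_rs // ltnW.
  by rewrite !scalerA mulrCA -natrM -expnD /e subnKC.
by move=> i j lt_ij; rewrite mxE; apply: (yP i).2.
Qed.

(** * Passage to the required form of [P], [Q] and the permutation *)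

Lemma perm_matrixE (R : nzRingType) (m : nat) (w : 'S_m) :
  perm_matrix R w = perm_mx w^-1.
Proof.
apply/matrixP=> i j; rewrite !mxE; congr (_%:R); congr nat_of_bool.
by apply/eqP/eqP=> [->|<-]; rewrite ?permK ?permKV.
Qed.

(** Filtering removes only a tail of entries equal to [k], which the default value restores. *)
Lemma nth_filter_ltn (k i : nat) (rs : seq nat) :
  sorted leq rs -> all (fun r => r <= k)%N rs ->
  nth k [seq r <- rs | (r < k)%N] i = nth k rs i.
Proof.
elim: rs i => [|r rs IHrs] i //=.
rewrite path_sortedE; last exact: leq_trans.
case/andP=> le_r sort_rs /andP[le_rk le_rs]; case: ifP => [_ | /negbT].
  by case: i => [|i] //=; apply: IHrs.
rewrite -leqNgt => le_kr; have Dr : r = k by apply/eqP; rewrite eqn_leq le_rk.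
have rsk x : x \in rs -> x = k.
  move=> rs_x; apply/eqP; rewrite eqn_leq (allP le_rs) //= -Dr.
  exact: (allP le_r).
have -> : [seq x <- rs | (x < k)%N] = [::].
  apply/eqP; rewrite -[_ == _]negbK -has_filter; apply/hasPn=> x /rsk ->.
  by rewrite ltnn.
rewrite nth_nil; case: i => [|i] //=.
case: (ltnP i (size rs)) => lt_i; last by rewrite nth_default.
by rewrite (rsk (nth k rs i)) ?mem_nth.
Qed.

Lemma exists_decomposition (p k m : nat) (C : {group 'rV['Z_(p ^ k)]_m}) :
  prime p -> (0 < k)%N ->
  exists (l : nat) (r : l.-tuple nat) (P : 'M['Z_(p ^ k)]_(l, m))
         (Q : 'M['Z_(p ^ k)]_m) (w : 'S_m), decomposition C r P Q w.
Proof.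
move=> p_pr k_gt0.
have [rs [Q0 [w [size_rs sort_rs le_rs uniQ0 DC]]]] :=
  exists_unreduced_decomposition p_pr k_gt0 (group_submodule C).
have [Q [A [[Qlow Qdiag] uA DQ ltQ]]] :=
  reduce_unitriangular p_pr k_gt0 sort_rs size_rs uniQ0.
pose rs' := [seq r <- rs | (r < k)%N].
have nth_rs' i : nth k rs' i = nth k rs i by apply: nth_filter_ltn.
pose P : 'M['Z_(p ^ k)]_(size rs', m) :=
  \matrix_(i, j) if i == j :> nat then (p ^ tnth (in_tuple rs') i)%:R else 0.
have size_rs' : (size rs' <= m)%N by rewrite -size_rs size_filter count_size.
(* The inverse accounts for [perm_matrix] and [perm_mx] having opposite conventions. *)
exists (size rs'), (in_tuple rs'), P, Q, w^-1%g; split.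
- split=> //.
  + by apply: sorted_filter sort_rs; apply: leq_trans.
  + move=> i; have : tnth (in_tuple rs') i \in rs' by apply: mem_tnth.
    by rewrite mem_filter => /andP[].
  + by move=> i j; rewrite mxE.
- split=> //; first exact: unitriangular_unitmx.
  by move=> i j lt_ij; rewrite /= !nth_rs' ltQ.
pose D := exponent_mx p k m rs.
have DP : P = pid_mx (size rs') *m D.
  apply/matrixP=> i j; rewrite mul_mx_diag !mxE ltn_ord andbT.
  rewrite (tnth_nth k) /= -nth_rs'.
  by have [<-|] := eqVneq (i : nat) j; rewrite ?mul1r ?mul0r.
(* The rows of [D] missing from [P] are zero, so padding [P] with zero rows recovers [D]. *)
have DD : pid_mx (size rs') *m P = D :> 'M_m.
  rewrite DP mulmxA mul_pid_mx minnn (minn_idPr _) //.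
  apply/matrixP=> i j; rewrite mul_mx_diag !mxE.
  rewrite val_eqE; have [<-|] := eqVneq i j; last by rewrite mul0r.
  rewrite mulr1n -nth_rs' /=.
  case: ltnP => [_ | le_i]; first by rewrite mul1r.
  by rewrite mul0r nth_default // natr_exp_ge.
rewrite DC perm_matrixE invgK -row_spaceE -mulmxA.
rewrite -(@row_space_mull _ _ _ _ A (invmx A)) ?mulKmx // !mulmxA -(mulmxA A) -DQ.
rewrite DP -!mulmxA; apply/esym; apply: (@row_space_mull _ _ _ _ _ (pid_mx (size rs'))).
by rewrite !mulmxA -(mulmxA _ (pid_mx _)) -DP DD.
Qed.

(** * Order and isomorphism type of a row space *)

Section DiagonalRows.
Variables (p k l m : nat) (e : 'I_l -> nat).
Variables (P : 'M['Z_(p ^ k)]_(l, m)) (U : 'M['Z_(p ^ k)]_m).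
Hypotheses (p_pr : prime p) (k_gt0 : (0 < k)%N) (le_lm : (l <= m)%N).
Hypothesis PE : forall (i : 'I_l) (j : 'I_m),
  P i j = if i == j :> nat then (p ^ e i)%:R else 0.
Hypothesis uU : U \in unitmx.

(** Cancelling [U] leaves one equation for each coordinate of [y] and [z]. The exponents may exceed
    [k]; the modulus is then 1 and the condition empty. *)
Lemma eq_mul_diag (y z : 'rV['Z_(p ^ k)]_l) :
  y *m (P *m U) = z *m (P *m U) <->
  (forall i, y 0 i = z 0 i %[mod p ^ (k - e i)]).
Proof.
have PU t : (t *m (P *m U)) *m invmx U = t *m P by rewrite mulmxA mulmxK.
have eq_entry i : y 0 i = z 0 i %[mod p ^ (k - e i)] <->
    y 0 i * (p ^ e i)%:R = z 0 i * (p ^ e i)%:R.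
  rewrite -{2}[y 0 i]natr_Zp -{2}[z 0 i]natr_Zp.
  by split=> /eqP; rewrite ?eq_natr_mul_exp // => H; apply/eqP;
     rewrite ?eq_natr_mul_exp.
split=> [/(congr1 (mulmxr (invmx U))) /= | yz].
  rewrite !PU => /rowP yz i; apply/eq_entry.
  have widenE (t : 'rV_l) : (t *m P) 0 (widen_ord le_lm i) = t 0 i * (p ^ e i)%:R.
    rewrite mxE (bigD1 i) //= big1 ?addr0 => [|j neq_ji]; first by rewrite PE eqxx.
    by rewrite PE /= val_eqE (negPf neq_ji) mulr0.
  by rewrite -!widenE yz.
rewrite !mulmxA; congr (_ *m U); apply/rowP=> j; rewrite !mxE.
apply: eq_bigr => i _; rewrite PE; case: eqP => _; last by rewrite !mulr0.
exact/eq_entry.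
Qed.

(** Each element has exactly one coefficient vector whose [i]-th representative is below
    [p ^ (k - e i)]. *)
Lemma card_row_space_diag :
  #|row_space (P *m U)| = (p ^ \sum_i (k - e i))%N.
Proof.
have q_gt1 := prime_power_gt1 p_pr k_gt0.
have p_gt0 := prime_gt0 p_pr.
pose F (i : 'I_l) := [pred a : 'Z_(p ^ k) | a < p ^ (k - e i)]%N.
pose g (y : {ffun 'I_l -> 'Z_(p ^ k)}) := (\row_i y i) *m (P *m U).
have -> : row_space (P *m U) = g @: family F.
  rewrite row_spaceE; apply/setP=> x; apply/imsetP/imsetP=> -[y]; last first.
    by move=> _ ->; exists (\row_i y i).
  move=> _ ->; pose z := [ffun i => (y ord0 i %% p ^ (k - e i))%:R : 'Z_(p ^ k)].
  have zE i : z i = (y ord0 i %% p ^ (k - e i))%N :> nat.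
    rewrite ffunE val_Zp_nat // modn_small //.
    apply: leq_ltn_trans (leq_mod _ _) _.
    by rewrite -[X in (_ < X)%N]Zp_cast.
  exists z.
    by apply/familyP=> i; rewrite inE zE ltn_mod expn_gt0 p_gt0.
  by apply/eq_mul_diag=> i; rewrite mxE zE modn_mod.
rewrite card_in_imset; last first.
  move=> y z /familyP Fy /familyP Fz /eq_mul_diag yz; apply/ffunP=> i.
  have := yz i; rewrite !mxE; have := Fy i; have := Fz i; rewrite !inE => lz ly.
  by rewrite !modn_small // => /val_inj.
rewrite card_family foldrE big_map big_enum expn_sum; apply: eq_bigr => i _ /=.
have le_pq : (p ^ (k - e i) <= (Zp_trunc (p ^ k)).+2)%N.
  by rewrite Zp_cast // leq_exp2l ?prime_gt1 // leq_subr.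
rewrite -sum1_card (eq_bigl (fun a : 'I__ => a < p ^ (k - e i))%N) //.
by rewrite (big_ord_narrow le_pq) /= sum1_card card_ord.
Qed.

Lemma row_space_diag_isog : (forall i, e i < k)%N ->
  ([group of row_space (P *m U)] \isog
   [set: {dffun forall i : 'I_l, 'Z_(p ^ (k - e (rev_ord i)))}])%g.
Proof.
move=> lt_ek; rewrite isog_sym.
have q_gt1 := prime_power_gt1 p_pr k_gt0.
(* Only for moduli above 1 does ['Z_n] really have [n] elements. *)
have m_gt1 i : (1 < p ^ (k - e i))%N by rewrite prime_power_gt1 // subn_gt0.
pose X := {dffun forall i : 'I_l, 'Z_(p ^ (k - e (rev_ord i)))}.
(* Lifting representatives is additive only modulo [p ^ (k - e i)], which is all that [eq_mul_diag]
   asks for. *)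
pose rowf (y : X) : 'rV['Z_(p ^ k)]_l :=
  \row_i (y (rev_ord i) : nat)%:R.
have rowfE (y : X) i : rowf y 0 (rev_ord i) = y i :> nat.
  rewrite mxE (rev_ordK i) val_Zp_nat // modn_small //.
  apply: leq_trans (ltn_ord _) _; rewrite Zp_cast //.
  by rewrite leq_exp2l ?prime_gt1 // leq_subr.
pose f (y : X) := rowf y *m (P *m U).
have fM : {in [set: X] &, {morph f : x y / (x * y)%g}}.
  move=> x y _ _; rewrite FinRing.zmodMgE /f -mulmxDl; apply/eq_mul_diag=> i.
  rewrite -[i]rev_ordK; set j := rev_ord i; rewrite rowfE ffunE mxE /=.
  have modZp a q : (1 < q)%N -> (a %% (Zp_trunc q).+2 = a %% q)%N.
    by move=> q1; rewrite Zp_cast.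
  rewrite !rowfE !modZp // modn_mod modn_dvdm //.
  by rewrite dvdn_exp2l // leq_subr.
apply/isogP; exists (Morphism fM).
  apply/injmP=> x y _ _ /eq_mul_diag xy; apply/ffunP=> j; apply/val_inj.
  have := xy (rev_ord j); rewrite !rowfE !modn_small //.
    by rewrite -[X in (_ < X)%N]Zp_cast.
  by rewrite -[X in (_ < X)%N]Zp_cast.
rewrite morphimEdom /= row_spaceE.
apply/setP=> x; apply/imsetP/imsetP=> -[y _ ->]; first by exists (rowf y).
exists [ffun i : 'I_l => (y ord0 (rev_ord i))%:R : 'Z_(p ^ (k - e (rev_ord i)))] => //.
apply/eq_mul_diag=> i; rewrite -[i]rev_ordK rowfE ffunE.
by rewrite val_Zp_nat // modn_mod.
Qed.
End DiagonalRows.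

(** * Uniqueness of the exponents and of [P] *)

(* The second difference in [t] of the truncated sum counts the entries equal
   to [t]. *)
Lemma eq_from_sum_subn (k : nat) (s1 s2 : seq nat) :
  sorted leq s1 -> sorted leq s2 ->
  all (fun x => x < k)%N s1 -> all (fun x => x < k)%N s2 ->
  (forall t, t <= k -> \sum_(x <- s1) (t - x) = \sum_(x <- s2) (t - x))%N ->
  s1 = s2.
Proof.
move=> sort1 sort2 lt1 lt2 eq_sum.
apply: (sorted_eq leq_trans anti_leq) => //.
have sumS s t : (\sum_(x <- s) (t.+1 - x) =
    \sum_(x <- s) (t - x) + count (fun x => x <= t) s)%N.
  rewrite -sum1_count (big_mkcond (fun x => x <= t)%N) -big_split /=.
  apply: eq_bigr => x _; case: leqP => [/subSn -> | lt_tx]; first by rewrite addn1.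
  have /eqP -> : (t.+1 - x == 0)%N by rewrite subn_eq0.
  by have /eqP -> : (t - x == 0)%N by rewrite subn_eq0 ltnW.
have eq_le t : (t < k)%N ->
    count (fun x => x <= t)%N s1 = count (fun x => x <= t)%N s2.
  move=> lt_tk; apply: (@addnI (\sum_(x <- s1) (t - x))%N).
  by rewrite -sumS eq_sum // sumS eq_sum // ltnW.
have countS s t : count (fun x => x <= t.+1)%N s =
    (count (fun x => x <= t)%N s + count_mem t.+1 s)%N.
  rewrite -count_predUI addnC [X in (X + _)%N](@eq_count _ _ pred0); last first.
    by move=> x /=; case: eqP => [->|]; rewrite ?ltnn ?andbF.
  rewrite count_pred0; apply: eq_count => x /=.
  by rewrite leq_eqVlt ltnS orbC.
apply/allP=> t _ /=; apply/eqP; case: (ltnP t k) => [|le_kt]; last first.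
  have count0 s : all (fun x => x < k)%N s -> count_mem t s = 0%N.
    move=> /allP lt_s; apply/count_memPn/negP=> /lt_s.
    by rewrite ltnNge le_kt.
  by rewrite !count0.
case: t => [|t] lt_tk.
  by have := eq_le 0%N lt_tk; congr (_ = _); apply: eq_count => x; rewrite leqn0.
apply: (@addnI (count (fun x => x <= t)%N s1)).
by rewrite -countS (eq_le t (ltnW lt_tk)) -countS eq_le.
Qed.

Lemma decomposition_unitmx (p k m l : nat) (C : {set 'rV['Z_(p ^ k)]_m})
    (r : l.-tuple nat) (P : 'M['Z_(p ^ k)]_(l, m)) (Q : 'M['Z_(p ^ k)]_m)
    (w : 'S_m) :
  decomposition C r P Q w ->
  exists2 U : 'M['Z_(p ^ k)]_m, U \in unitmx & C = row_space (P *m U).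
Proof.
case=> _ [uQ _ _ _] ->; exists (Q *m perm_matrix _ w); last by rewrite mulmxA.
by rewrite unitmx_mul uQ perm_matrixE unitmx_perm.
Qed.

(** Scaling by [p ^ s] adds [s] to every exponent, so the count for diagonal rows applies again. *)
Lemma card_scaled_decomposition (p k m l : nat) (C : {set 'rV['Z_(p ^ k)]_m})
    (r : l.-tuple nat) (P : 'M['Z_(p ^ k)]_(l, m)) (Q : 'M['Z_(p ^ k)]_m)
    (w : 'S_m) (s : nat) :
  prime p -> (0 < k)%N -> decomposition C r P Q w ->
  #|[set (p ^ s)%:R *: x | x in C]| = (p ^ \sum_(x <- r) (k - s - x))%N.
Proof.
move=> p_pr k_gt0 decC; have [U uU ->] := decomposition_unitmx decC.
have [[le_lm _ _ PE] _ _] := decC.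
pose e i := (s + tnth r i)%N.
have sPE (i : 'I_l) (j : 'I_m) :
    ((p ^ s)%:R *: P) i j = if i == j :> nat then (p ^ e i)%:R else 0.
  by rewrite mxE PE; case: eqP => _; rewrite ?mulr0 // -natrM -expnD.
have -> : [set (p ^ s)%:R *: x | x in row_space (P *m U)] =
    row_space (((p ^ s)%:R *: P) *m U).
  rewrite !row_spaceE; apply/setP=> x; apply/imsetP/imsetP.
    case=> _ /imsetP[y _ ->] ->; exists y => //.
    by rewrite -scalemxAl -scalemxAr.
  case=> y _ ->; exists (y *m (P *m U)); first by apply/imsetP; exists y.
  by rewrite -scalemxAl -scalemxAr.
rewrite (card_row_space_diag p_pr k_gt0 le_lm sPE uU); congr (_ ^ _)%N.
by rewrite big_tuple; apply: eq_bigr => i _; rewrite /e subnDA.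
Qed.

Lemma decomposition_exponents_uniq (p k m l1 l2 : nat)
    (C : {set 'rV['Z_(p ^ k)]_m}) (r1 : l1.-tuple nat) (r2 : l2.-tuple nat)
    (P1 : 'M['Z_(p ^ k)]_(l1, m)) (P2 : 'M['Z_(p ^ k)]_(l2, m))
    (Q1 Q2 : 'M['Z_(p ^ k)]_m) (w1 w2 : 'S_m) :
  prime p -> (0 < k)%N ->
  decomposition C r1 P1 Q1 w1 -> decomposition C r2 P2 Q2 w2 ->
  r1 = r2 :> seq nat.
Proof.
move=> p_pr k_gt0 dec1 dec2.
have [[_ sort1 lt1 _] _ _] := dec1; have [[_ sort2 lt2 _] _ _] := dec2.
apply: (@eq_from_sum_subn k) => //; try by apply/all_tnthP.
move=> t le_tk; apply/eqP; rewrite -(@eqn_exp2l p) ?prime_gt1 //.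
(* Scaling by [p ^ (k - t)] turns the summands into [t - x]. *)
have := card_scaled_decomposition (k - t) p_pr k_gt0 dec1.
by rewrite (card_scaled_decomposition _ p_pr k_gt0 dec2) subKn // => ->.
Qed.

Theorem theorem3p9 (p k m : nat) (p_prime : prime p) (k_gt0 : (1 <= k)%N)
    (m_gt0 : (1 <= m)%N) (C : {group 'rV['Z_(p ^ k)]_m}) :
  [/\ exists (l : nat) (r : l.-tuple nat) (P : 'M['Z_(p ^ k)]_(l, m))
             (Q : 'M['Z_(p ^ k)]_m) (w : 'S_m),
        decomposition C r P Q w,
      forall (l : nat) (r : l.-tuple nat) (P : 'M['Z_(p ^ k)]_(l, m))
             (Q : 'M['Z_(p ^ k)]_m) (w : 'S_m),
        decomposition C r P Q w ->
        (C \isog [set: {dffun forall i : 'I_l,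
                          'Z_(p ^ (k - tnth r (rev_ord i)))}])%g
    & forall (l1 l2 : nat) (r1 : l1.-tuple nat) (r2 : l2.-tuple nat)
             (P1 : 'M['Z_(p ^ k)]_(l1, m)) (P2 : 'M['Z_(p ^ k)]_(l2, m))
             (Q1 Q2 : 'M['Z_(p ^ k)]_m) (w1 w2 : 'S_m),
        decomposition C r1 P1 Q1 w1 -> decomposition C r2 P2 Q2 w2 ->
        Tagged (fun l : nat => 'M['Z_(p ^ k)]_(l, m)) P1 =
        Tagged (fun l : nat => 'M['Z_(p ^ k)]_(l, m)) P2].
Proof.
split=> [|l r P Q w decC|]; first exact: exists_decomposition.
  have [U uU ->] := decomposition_unitmx decC.
  have [[le_lm _ lt_rk PE] _ _] := decC.
  exact: (row_space_diag_isog p_prime k_gt0 le_lm PE uU).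
move=> l1 l2 r1 r2 P1 P2 Q1 Q2 w1 w2 dec1 dec2.
have eq_r := decomposition_exponents_uniq p_prime k_gt0 dec1 dec2.
have eq_l : l1 = l2 by rewrite -(size_tuple r1) -(size_tuple r2) eq_r.
(* Only once the numbers of rows are identified do [P1] and [P2] have the same type. *)
subst l2.
have {}eq_r : r1 = r2 by apply: val_inj.
have [[_ _ _ PE1] _ _] := dec1; have [[_ _ _ PE2] _ _] := dec2.
by congr Tagged; apply/matrixP=> i j; rewrite PE1 PE2 eq_r.
Qed.
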